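(* Every OrderSPN is complete and decomposable, and every regular OrderSPN is additionally deterministic.
   Context: Fix $d\ge2$. For $S\subseteq\{1,\dots,d\}$, $\sigma_S$ denotes a linear ordering of $S$, and $G_S=(G_i)_{i\in S}$ a tuple of parent sets $G_i\subseteq\{1,\dots,d\}$. A sum-product network (SPN) is a rooted DAG of leaf, product and sum nodes, each node $N$ representing a probability distribution over the variables in its scope $sc(N)$. Leaves carry given distributions; a product node is the product of its children's distributions; a sum node $T$ is $\sum_i\phi_{T,i}C_i$ over its children $C_i$, with weights $\phi_{T,i}>0$, $\sum_i\phi_{T,i}=1$. An OrderSPN is an SPN over $(\sigma,G)$, with $\sigma$ an order of $\{1,\dots,d\}$ and $G$ a directed graph on $\{1,\dots,d\}$, whose root is associated with $(\emptyset,\{1,\dots,d\})$ and such that: (1) Each leaf $L$ is associated with $(S_1,\{i\})$ for some $S_1\subseteq\{1,\dots,d\}$ and $i\notin S_1$, has scope $(\sigma_{\{i\}},G_i)$, and its distribution has support only on $G_i\subseteq S_1$. (2) Each sum node $T$ is associated with disjoint subsets $(S_1,S_2)$ with $|S_2|>1$ and has scope $(\sigma_{S_2},G_{S_2})$. It has $K_T$ children; the $i$-th child is a product node associated with $(S_1,S_{21,i},S_{22,i})$ for some partition $(S_{21,i},S_{22,i})$ of $S_2$. (3) Each product node $P$ is associated with three disjoint subsets $(S_1,S_{21},S_{22})$ and has scope $(\sigma_{S_{21}\cup S_{22}},G_{S_{21}\cup S_{22}})$, where the ordering has the form of the concatenation $(\sigma_{S_{21}},\sigma_{S_{22}})$ (orderings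 not of this form have probability $0$ under $P$). It has two children, the first associated with $(S_1,S_{21})$ and the second with $(S_1\cup S_{21},S_{22})$; these are sum nodes or leaves. An OrderSPN is regular if it is organized in alternating layers of sum and product nodes starting from the root sum node, every sum node in the $j$-th sum layer has the same number $K_j$ of children, and for each sum node with set $S_2$, all its children satisfy $|S_{21,i}|=\lfloor|S_2|/2\rfloor$, $|S_{22,i}|=\lceil|S_2|/2\rceil$, with the partitions $(S_{21,i},S_{22,i})$ (as ordered pairs) distinct for different children $i$. Properties of an SPN: complete means that for every sum node all children have the same scope; decomposable means that for every product node any two distinct children have disjoint scopes (scopes $(\sigma_S,G_S)$ and $(\sigma_{S'},G_{S'})$ are disjoint iff $S\cap S'=\emptyset$); deterministic means that for every sum node and every instantiation of its scope, at most one of its children assigns it nonzero probability. *)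

(* Defs.v *)
From HB Require Import structures.
From mathcomp Require Import all_boot all_order all_algebra.

Set Implicit Arguments.
Unset Strict Implicit.
Unset Printing Implicit Defensive.

Import Order.TTheory GRing.Theory Num.Theory.
Local Open Scope ring_scope.

(* An instantiation of the variables (sigma_S, G_S), for S a set of indices:
   the ordering sigma_S is the list of the elements of S, each occurring once,
   in increasing order for sigma_S; the tuple G_S of parent sets is extended by
   the empty set outside S.  The scope (sigma_S, G_S) is represented by S. *)
Definition inst (d : nat) : Type :=
  (seq 'I_d * {ffun 'I_d -> {set 'I_d}})%type.

Definition insts (d : nat) (S : {set 'I_d}) : seq (inst d) :=
  [seq (s, g) | s <- permutations (enum S),
                g <- enum (pffun_on set0 (mem S) [pred A : {set 'I_d} | true])].

Definition restr_ord (d : nat) (S : {set 'I_d}) (s : seq 'I_d) : seq 'I_d :=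
  [seq i <- s | i \in S].

Definition restr (d : nat) (S : {set 'I_d}) (x : inst d) : inst d :=
  (restr_ord S x.1, [ffun i => if i \in S then x.2 i else set0]).

Variant node_kind := Leaf | Sum | Prod.

(* A sum-product network over (sigma, G).
   - [pr n x] is the probability that [n] gives to x, meaningful only for
     x \in insts (sc n).
   - A child is evaluated at the restriction of x to its own scope, so that the
     equations make sense without completeness or decomposability.
   - Only the leaves are required to be normalised: requiring it of a sum node
     would force its children to have the same scope.
   - The order of the children of a product node matters: the product of
     distributions over (sigma_A, G_A) and (sigma_B, G_B) is the distribution
     over (sigma_(A u B), G_(A u B)) carried by the orderings of A u B that are
     an ordering of A followed by an ordering of B. *)
Record spn (R : realFieldType) (d : nat) := Spn {
  node : finType;
  root : node;
  kind : node -> node_kind;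
  children : node -> seq node;
  sc : node -> {set 'I_d};
  weight : node -> node -> R;
  pr : node -> inst d -> R;

  children_uniq : forall n, uniq (children n);
  spn_acyclic : forall n c, c \in children n ->
    ~~ connect (grel children) c n;
  spn_rooted : forall n, connect (grel children) root n;
  leaf_childless : forall n, kind n = Leaf <-> children n = [::];
  sc_internal : forall n, kind n <> Leaf ->
    sc n = \bigcup_(c <- children n) sc c;

  weight_gt0 : forall t c, kind t = Sum -> c \in children t -> 0 < weight t c;
  weight_sum1 : forall t, kind t = Sum ->
    \sum_(c <- children t) weight t c = 1;

  pr_leaf_ge0 : forall l x, kind l = Leaf -> x \in insts (sc l) -> 0 <= pr l x;
  pr_leaf_sum1 : forall l, kind l = Leaf -> \sum_(x <- insts (sc l)) pr l x = 1;
  pr_sum : forall t x, kind t = Sum -> x \in insts (sc t) ->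
    pr t x = \sum_(c <- children t) weight t c * pr c (restr (sc c) x);
  pr_prod : forall p x, kind p = Prod -> x \in insts (sc p) ->
    pr p x =
      if x.1 == flatten [seq restr_ord (sc c) x.1 | c <- children p]
      then \prod_(c <- children p) pr c (restr (sc c) x)
      else 0
}.

Definition complete (R : realFieldType) (d : nat) (N : spn R d) : Prop :=
  forall t : node N, kind t = Sum ->
  forall c c', c \in children t -> c' \in children t -> sc c = sc c'.

Definition decomposable (R : realFieldType) (d : nat) (N : spn R d) : Prop :=
  forall p : node N, kind p = Prod ->
  forall c c', c \in children p -> c' \in children p -> c != c' ->
  [disjoint sc c & sc c'].

Definition deterministic (R : realFieldType) (d : nat) (N : spn R d) : Prop :=
  forall t : node N, kind t = Sum ->
  forall x, x \in insts (sc t) ->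
  forall c c', c \in children t -> c' \in children t ->
  pr c (restr (sc c) x) != 0 -> pr c' (restr (sc c') x) != 0 -> c = c'.

Variant assoc (d : nat) :=
  | Pair of {set 'I_d} & {set 'I_d}
  | Triple of {set 'I_d} & {set 'I_d} & {set 'I_d}.

(* That orderings not of the form (sigma_S21, sigma_S22) have probability 0
   under a product node is part of [pr_prod]. *)
Record order_spn (R : realFieldType) (d : nat) := OrderSpn {
  order_spn_spn :> spn R d;
  lab : node order_spn_spn -> assoc d;

  lab_root : lab (root order_spn_spn) = Pair set0 [set: 'I_d];
  order_leaf : forall l, kind l = Leaf ->
    exists S1 i,
      [/\ lab l = Pair S1 [set i],
          i \notin S1,
          sc l = [set i]
        & forall x, x \in insts [set i] -> pr l x != 0 -> x.2 i \subset S1];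
  order_sum : forall t, kind t = Sum ->
    exists S1 S2,
      [/\ lab t = Pair S1 S2,
          [disjoint S1 & S2],
          (1 < #|S2|)%N,
          sc t = S2
        & forall c, c \in children t ->
            kind c = Prod /\
            exists S21 S22,
              [/\ lab c = Triple S1 S21 S22,
                  S21 :|: S22 = S2
                & [disjoint S21 & S22]]];
  order_prod : forall p, kind p = Prod ->
    exists S1 S21 S22,
      [/\ lab p = Triple S1 S21 S22,
          [/\ [disjoint S1 & S21], [disjoint S1 & S22] & [disjoint S21 & S22]],
          sc p = S21 :|: S22
        & exists c1 c2,
            [/\ children p = [:: c1; c2],
                lab c1 = Pair S1 S21,
                lab c2 = Pair (S1 :|: S21) S22,
                kind c1 = Sum \/ kind c1 = Leaf
              & kind c2 = Sum \/ kind c2 = Leaf]]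
}.

(* Layers are numbered from 0 at the root, so the sum layers are the even ones.
   Leaves belong to no layer: the value of [layer] on them is irrelevant. *)
Definition regular (R : realFieldType) (d : nat) (N : order_spn R d) : Prop :=
  [/\ kind (root N) = Sum,
      exists (layer : node N -> nat) (K : nat -> nat),
        [/\ layer (root N) = 0%N,
            forall n c : node N, c \in children n -> kind c <> Leaf ->
              layer c = (layer n).+1,
            forall n : node N, kind n = Sum -> ~~ odd (layer n),
            forall n : node N, kind n = Prod -> odd (layer n)
          & forall t : node N, kind t = Sum ->
              size (children t) = K (layer t)./2],
      forall (t c : node N) S1 S2 S1' S21 S22,
        kind t = Sum -> c \in children t ->
        lab t = Pair S1 S2 -> lab c = Triple S1' S21 S22 ->
        #|S21| = #|S2|./2 /\ #|S22| = uphalf #|S2|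
    & forall (t c c' : node N) S1 S1' S21 S22,
        kind t = Sum -> c \in children t -> c' \in children t ->
        lab c = Triple S1 S21 S22 -> lab c' = Triple S1' S21 S22 -> c = c'].

(* Main.v *)
(** In a regular OrderSPN an ordering to which a product node gives nonzero
    probability starts with an ordering of [S21], and the size of [S21] is the
    same for all children of a sum node.  Hence [S21], and then its complement
    [S22] in [S2], can be read off a prefix of the ordering, and the partition
    identifies the child. *)
Require Import Defs.
From mathcomp Require Import all_boot all_order all_algebra.

Set Implicit Arguments.
Unset Strict Implicit.
Unset Printing Implicit Defensive.

Lemma instsP (d : nat) (S : {set 'I_d}) (x : inst d) :
  x \in insts S -> perm_eq x.1 (enum S) /\ forall i, i \notin S -> x.2 i = set0.
Proof.
case/allpairsP=> -[s g] /= [sP gP ->]; split=> /=.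
  by rewrite -mem_permutations.
move=> i iS; move: gP; rewrite mem_enum => /pffun_onP [/supportP gS _].
exact: gS.
Qed.

(** The ordering lists only elements of [S], and the parent sets already have the default value
    [set0] outside [S]. Together with completeness, this lets every child of a sum node be evaluated
    at [x] itself. *)
Lemma restr_id (d : nat) (S : {set 'I_d}) (x : inst d) :
  x \in insts S -> restr S x = x.
Proof.
case: x => s g /instsP [/= sS gS]; congr pair.
  by apply/all_filterP/allP => i; rewrite (perm_mem sS) mem_enum.
by apply/ffunP => i; rewrite ffunE; case: ifPn => // /gS ->.
Qed.

(** [restr_ord A s] has no repetition and exactly the elements of [A], so its length is [#|A|] and
    the prefix of that length is all of it. *)
Lemma set_take_restr_ord (d : nat) (S A B : {set 'I_d}) (s : seq 'I_d) :
  perm_eq s (enum S) -> A \subset S -> s = restr_ord A s ++ restr_ord B s ->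
  [set i in take #|A| s] = A.
Proof.
move=> sS AS sAB.
have memA : restr_ord A s =i A.
  move=> i; rewrite mem_filter (perm_mem sS) mem_enum andb_idr //.
  exact: (subsetP AS).
have uA : uniq (restr_ord A s).
  by rewrite filter_uniq // (perm_uniq sS) enum_uniq.
rewrite {1}sAB -(eq_card memA) (card_uniqP uA) take_size_cat //.
by apply/setP => i; rewrite inE memA.
Qed.

Section OrderSPN.
Variables (R : realFieldType) (d : nat) (N : order_spn R d).
Implicit Types (n c p t : node N) (S : {set 'I_d}).

Lemma sc_Pair n S1 S2 :
  kind n = Sum \/ kind n = Leaf -> lab n = Pair S1 S2 -> sc n = S2.
Proof.
case=> [/order_sum [A [B [-> _ _ -> _]]]|/order_leaf [A [i [-> _ -> _]]]];
  by case.
Qed.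

Lemma sc_Triple p S1 S21 S22 :
  kind p = Prod -> lab p = Triple S1 S21 S22 -> sc p = S21 :|: S22.
Proof. by case/order_prod=> [A [B [C [-> _ -> _]]]] [_ -> ->]. Qed.

(** The two parts of a child's partition recombine to the second set of the sum node's label, which
    is its scope. *)
Lemma sc_child_sum t c : kind t = Sum -> c \in children t -> sc c = sc t.
Proof.
case/order_sum=> [S1 [S2 [_ _ _ -> chP]]] /chP [kc [S21 [S22 [labc <- _]]]].
exact: sc_Triple labc.
Qed.

Lemma sc_children_prod p S1 S21 S22 :
  kind p = Prod -> lab p = Triple S1 S21 S22 ->
  exists c1 c2, [/\ children p = [:: c1; c2], sc c1 = S21 & sc c2 = S22].
Proof.
case/order_prod=> [A [B [C [-> _ _ [c1 [c2 [chp l1 l2 k1 k2]]]]]]] [_ <- <-].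
by exists c1, c2; split=> //; [apply: sc_Pair l1 | apply: sc_Pair l2].
Qed.

(** If the equality failed, the conditional in [pr_prod] would give 0. *)
Lemma pr_prod_neq0 p S1 S21 S22 x :
  kind p = Prod -> lab p = Triple S1 S21 S22 -> x \in insts (sc p) ->
  pr p x != 0%R -> x.1 = restr_ord S21 x.1 ++ restr_ord S22 x.1.
Proof.
move=> kp labp xp; rewrite (pr_prod kp xp).
have [c1 [c2 [-> <- <-]]] := sc_children_prod kp labp.
by rewrite /= cats0; case: ifP => [/eqP //|]; rewrite eqxx.
Qed.

Lemma order_spn_complete : complete N.
Proof. by move=> t kt c c' ct c't; rewrite !(sc_child_sum kt). Qed.

Lemma order_spn_decomposable : decomposable N.
Proof.
move=> p kp; have [S1 [S21 [S22 [labp [_ _ dS] _ _]]]] := order_prod kp.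
have [c1 [c2 [-> sc1 sc2]]] := sc_children_prod kp labp.
move=> c c'; rewrite !inE => /orP[]/eqP-> /orP[]/eqP->; rewrite ?eqxx //.
  by rewrite sc1 sc2.
by rewrite sc1 sc2 disjoint_sym.
Qed.

Lemma regular_deterministic : regular N -> deterministic N.
Proof.
case=> _ _ half inj t kt x xt c c' ct c't.
rewrite !(sc_child_sum kt) // !restr_id // => prc prc'.
have [S1 [S2 [labt _ _ sct chP]]] := order_sum kt.
have xS2 : perm_eq x.1 (enum S2) by rewrite -sct; case: (instsP xt).
(* With the second part written as [S2 :\: S21], only [S21] remains unknown in the label, and the
   prefix set depends on [x] but not on [n]. *)
have childP n : n \in children t -> pr n x != 0%R ->
    exists S21, [/\ lab n = Triple S1 S21 (S2 :\: S21)
                  & S21 = [set i in take #|S2|./2 x.1]].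
  move=> nt prn; have [kn [S21 [S22 [labn defS2 dS]]]] := chP n nt.
  have xn : x \in insts (sc n) by rewrite (sc_child_sum kt).
  exists S21; split.
    rewrite labn -defS2 setDUl setDv set0U; congr Triple.
    by apply/esym/setDidPl; rewrite disjoint_sym.
  (* Regularity turns the length [#|S2|./2], common to all children, into [#|S21|]. *)
  have [<- _] := half _ _ _ _ _ _ _ kt nt labt labn.
  apply/esym/(set_take_restr_ord xS2 _ (pr_prod_neq0 kn labn xn prn)).
  by rewrite -defS2 subsetUl.
have [A [labc defA]] := childP c ct prc.
have [B [labc' defB]] := childP c' c't prc'.
by rewrite defB -defA in labc'; apply: (inj t c c') labc labc'.
Qed.

End OrderSPN.

Theorem proposition3 (R : realFieldType) (d : nat) (hd : (2 <= d)%N)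
    (N : order_spn R d) :
  [/\ complete N, decomposable N & regular N -> deterministic N].
Proof.
split; first exact: order_spn_complete.
  exact: order_spn_decomposable.
exact: regular_deterministic.
Qed.
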